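(* Let $n \in \mathbb{N}$, let $\Theta \in [0,\pi/2)$, let $A \in \mathbb{C}^{m\times m}$, and consider the iteration $$X_{k+1} = r_{2n+1}(X_k;\Theta_k), \quad X_0 = A, \qquad \Theta_{k+1} = |\arg r_{2n+1}(e^{i\Theta_k};\Theta_k)|, \quad \Theta_0 = \Theta,$$ where $r_{2n+1}(\cdot\,;\Theta)$ is the rational function defined in the context. This iteration is structure-preserving: if $A$ is unitary, then $X_k$ is unitary for every $k \ge 0$.
   Context: $\mathrm{sn}(\cdot,\ell),\mathrm{cn}(\cdot,\ell),\mathrm{dn}(\cdot,\ell)$ denote Jacobi's elliptic functions with modulus $\ell$, and $K(\ell)=\int_0^{\pi/2}(1-\ell^2\sin^2\theta)^{-1/2}\,d\theta$ is the complete elliptic integral of the first kind. For $\Theta\in[0,\pi/2)$ put $\ell=\cos\Theta$, $\ell'=\sqrt{1-\ell^2}=\sin\Theta$, and for $n\in\mathbb{N}_0$ and $j=1,\dots,n$ put $v_j=\frac{2j-1}{2n+1}K(\ell')$ and $$a_j=a_j(\Theta)=\left(\frac{\ell\,\mathrm{sn}(v_j,\ell')+\mathrm{dn}(v_j,\ell')}{\mathrm{cn}(v_j,\ell')}\right)^{2(-1)^{j+n}} .$$ (For $\Theta=0$ this uses modulus $\ell'=0$, where $\mathrm{sn}=\sin$, $\mathrm{cn}=\cos$, $\mathrm{dn}=1$, $K(0)=\pi/2$.) Define $$r_{2n+1}(z;\Theta)=z\prod_{j=1}^n\frac{z^2+a_j(\Theta)}{1+a_j(\Theta)z^2}.$$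 Here $\arg$ takes values in $(-\pi,\pi]$, and $r_{2n+1}(X;\Theta)$ for a square matrix $X$ means $X\prod_{j=1}^n (X^2+a_j I)(I+a_jX^2)^{-1}$. *)

(* Defs.v *)
From HB Require Import structures.
From mathcomp Require Import all_boot all_order all_algebra.
From mathcomp Require Import all_classical all_reals all_analysis.
From mathcomp Require Import complex.

Set Implicit Arguments.
Unset Strict Implicit.
Unset Printing Implicit Defensive.

Import Order.TTheory GRing.Theory Num.Theory.
Import numFieldNormedType.Exports.

Local Open Scope classical_set_scope.
Local Open Scope ring_scope.
Local Open Scope complex_scope.

Section JacobiElliptic.
Context {R : realType}.
Implicit Types l u phi t : R.

(* [l] is the modulus (not the parameter l ^+ 2); all the functions below are
   meaningful for 0 <= l < 1. *)
Definition ellint_integrand l t : R := (Num.sqrt (1 - l ^+ 2 * sin t ^+ 2))^-1.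

Definition ellint_K l : R :=
  \int[lebesgue_measure]_(t in `[0, pi / 2]) ellint_integrand l t.

(* Oriented integral from 0 to phi: one of the two domains is empty or {0}. *)
Definition ellint_F l phi : R :=
  (\int[lebesgue_measure]_(t in `[0, phi]) ellint_integrand l t)
  - (\int[lebesgue_measure]_(t in `[phi, 0]) ellint_integrand l t).

(* Jacobi's amplitude, the inverse function of [ellint_F l] (a bijection of R
   onto itself when 0 <= l < 1). *)
Definition jacobi_am l u : R := xget 0 [set phi | ellint_F l phi = u].

(* The argument order is that of the notation sn(u, l). *)
Definition jacobi_sn u l : R := sin (jacobi_am l u).
Definition jacobi_cn u l : R := cos (jacobi_am l u).
Definition jacobi_dn u l : R := Num.sqrt (1 - l ^+ 2 * jacobi_sn u l ^+ 2).

End JacobiElliptic.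

Section Zolotarev.
Context {R : realType}.
Implicit Types (n j : nat) (Theta : R) (z : R[i]).

Definition cis Theta : R[i] := cos Theta +i* sin Theta.

(* Principal argument, in ]-pi, pi]; the value at z = 0 is irrelevant. *)
Definition carg z : R :=
  xget 0 [set t : R | - pi < t <= pi /\ z = `|z| * cis t].

Definition zolo_v n Theta j : R :=
  let l := cos Theta in
  let l' := Num.sqrt (1 - l ^+ 2) in
  (2 * j%:R - 1) / (2 * n%:R + 1) * ellint_K l'.

(* The exponent is an integer, equal to 2 or to -2. *)
Definition zolo_a n Theta j : R :=
  let l := cos Theta in
  let l' := Num.sqrt (1 - l ^+ 2) in
  let v := zolo_v n Theta j in
  ((l * jacobi_sn v l' + jacobi_dn v l') / jacobi_cn v l')
    ^ (2 * (-1) ^+ (j + n) : int).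

(* [zolo_r n Theta z] is r_{2n+1}(z; Theta). *)
Definition zolo_r n Theta z : R[i] :=
  z * \prod_(1 <= j < n.+1)
        ((z ^+ 2 + (zolo_a n Theta j)%:C) / (1 + (zolo_a n Theta j)%:C * z ^+ 2)).

Definition zolo_den n Theta m (X : 'M[R[i]]_m) j : 'M[R[i]]_m :=
  1%:M + (zolo_a n Theta j)%:C *: X ^+ 2.

(* [invmx] is a total function, returning its argument when it is singular;
   the value below is r_{2n+1}(X; Theta) when every [zolo_den n Theta X j] with
   1 <= j <= n is invertible. *)
Definition zolo_rmx n Theta m (X : 'M[R[i]]_m) : 'M[R[i]]_m :=
  X *m \prod_(1 <= j < n.+1)
         ((X ^+ 2 + ((zolo_a n Theta j)%:C)%:M) *m invmx (zolo_den n Theta X j)).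

End Zolotarev.

(* Main.v *)
Require Import Defs.
From HB Require Import structures.
From mathcomp Require Import all_boot all_order all_algebra.
From mathcomp Require Import all_classical all_reals all_analysis.
From mathcomp Require Import complex.
From mathcomp Require Import ring lra.

Set Implicit Arguments.
Unset Strict Implicit.
Unset Printing Implicit Defensive.

Import Order.TTheory GRing.Theory Num.Theory.
Import numFieldNormedType.Exports.

Local Open Scope ring_scope.
Local Open Scope complex_scope.

(**
  Matrix side. For a unitary X, put Y = X ^+ 2, let a be real with a ^ 2 != 1,
  and let D = 1 + a Y. The eigenvalues of Y lie on the unit circle, so D is
  invertible. Since Y Y^* = 1, the numerator Y + a equals Y D^*, so a factor
  of r(X) is Y D^* D^-1; as D is normal, D^* D^-1 is unitary
  ([unitarymx_cayley]). So it remains to see that every a_j differs from 1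
  and -1, and that the angle Theta_k never leaves [0, pi/2), the range in
  which this is guaranteed.

  Elliptic side. The amplitude is the inverse of an increasing continuous
  integral, hence phi_j = am(v_j, l') lies in (0, pi/2) and increases with j
  ([jacobi_amP], [le_jacobi_am]). As l'^2 = 1 - l^2, the quotient which defines
  a_j is x + sqrt(1 + x^2) at x = l tan(phi_j) > 0
  ([zolo_base_tan]). It therefore exceeds 1 and increases with j
  ([zolo_base_spec]). In particular a_j is positive and different from 1.

  Angles. With z = cis t, z^2 + a = z (z + a z^-1) and
  1 + a z^2 = z (z^-1 + a z), two complex conjugates times z; so the factor of
  index j contributes twice the angle atan ((1 - a_j) / (1 + a_j) tan t)
  ([cis_moebius]). Because of the exponents 2 and -2 this arctangent is
  - (-1)^(j+n) beta_j with beta_j = atan (kappa_j tan t), where kappa_j lies in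
  (0, 1) and increases with j. Thus at t = Theta

     r (cis Theta) = cis (Theta - 2 S),
     S = beta_n - beta_(n-1) + beta_(n-2) - ...

  and an alternating sum of nonnegative increasing terms lies between 0 and
  its largest term, which is at most Theta ([alternating_sum_bounds]). Hence
  the argument of r (cis Theta) lies in [-Theta, Theta] ([zolo_r_cis]), and the
  new angle is below pi/2 ([carg_cis_lt]).
*)

(** * Elliptic integral and amplitude *)

Section EllipticIntegral.
Context {R : realType}.
Implicit Types l t u v phi : R.

Lemma ellint_radicand_gt0 l t : l ^+ 2 < 1 -> 0 < 1 - l ^+ 2 * sin t ^+ 2.
Proof.
move=> l1; rewrite subr_gt0; apply: le_lt_trans l1.
by rewrite ler_piMr ?sqr_ge0// sin2cos2 lerBlDr lerDl sqr_ge0.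
Qed.

Lemma ellint_integrand_ge1 l t : l ^+ 2 < 1 -> 1 <= ellint_integrand l t.
Proof.
move=> l1; have h := ellint_radicand_gt0 t l1.
rewrite /ellint_integrand invf_ge1 ?sqrtr_gt0// -sqrtr1 ler_sqrt ?ltr01//.
by rewrite sqrtr1 gerBl mulr_ge0 ?sqr_ge0.
Qed.

Lemma continuous_ellint_integrand l :
  l ^+ 2 < 1 -> continuous (ellint_integrand l).
Proof.
move=> l1 t; apply: cvgV.
  by rewrite gt_eqF// sqrtr_gt0 ellint_radicand_gt0.
apply: (@continuous_comp _ _ _ (fun t => 1 - l ^+ 2 * sin t ^+ 2) Num.sqrt);
  last exact: sqrt_continuous.
apply: continuousB; first exact: cvg_cst.
apply: continuousM; first exact: cvg_cst.
by apply: (@continuous_comp _ _ _ (@sin R) (fun y => y ^+ 2));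
  [exact: continuous_sin | exact: exprn_continuous].
Qed.

Lemma integrable_ellint_integrand l a b : l ^+ 2 < 1 ->
  (@lebesgue_measure R).-integrable `[a, b]%classic
    (EFin \o ellint_integrand l).
Proof.
move=> l1; apply: continuous_compact_integrable; first exact: segment_compact.
exact/continuous_subspaceT/continuous_ellint_integrand.
Qed.

Lemma ellint_F_ge0E l phi : 0 <= phi -> ellint_F l phi =
  parameterized_integral lebesgue_measure 0 phi (ellint_integrand l).
Proof.
rewrite /ellint_F /parameterized_integral le_eqVlt => /predU1P[<-|phi0].
  by rewrite set_itv1 Rintegral_set1 subr0.
by rewrite (@set_itv_ge _ _ _ (BRight 0)) ?Rintegral_set0 ?subr0// bnd_simp -ltNge.
Qed.

Lemma ellint_F0 l : ellint_F l 0 = 0.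
Proof. by rewrite ellint_F_ge0E// /parameterized_integral set_itv1 Rintegral_set1. Qed.

(** For phi < 0 only the subtracted half of [ellint_F] survives. *)
Lemma ellint_F_le0 l phi : l ^+ 2 < 1 -> phi <= 0 -> ellint_F l phi <= 0.
Proof.
move=> l1; rewrite le_eqVlt => /predU1P[->|phi0]; first by rewrite ellint_F0.
rewrite /ellint_F set_itv_ge ?bnd_simp -?ltNge// Rintegral_set0 sub0r oppr_le0.
by apply: Rintegral_ge0 => t _; exact: le_trans (ellint_integrand_ge1 t l1).
Qed.

Lemma le_ellint_F l phi psi : l ^+ 2 < 1 -> 0 <= phi <= psi ->
  ellint_F l phi <= ellint_F l psi.
Proof.
move=> l1 /andP[phi0 phipsi].
rewrite !ellint_F_ge0E ?(le_trans phi0 phipsi)// -subr_ge0.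
rewrite /parameterized_integral Rintegral_itvB ?bnd_simp//; last first.
  exact: integrable_ellint_integrand.
by apply: Rintegral_ge0 => t _; exact: le_trans (ellint_integrand_ge1 t l1).
Qed.

Lemma ellint_F_pihalf l : ellint_F l (pi / 2) = ellint_K l.
Proof. by rewrite ellint_F_ge0E// divr_ge0// pi_ge0. Qed.

Lemma ellint_K_gt0 l : l ^+ 2 < 1 -> 0 < ellint_K l.
Proof.
move=> l1; have pi2 : 0 < pi / 2 :> R by rewrite divr_gt0// pi_gt0.
apply: (lt_le_trans pi2).
have := @le_Rintegral _ _ R lebesgue_measure `[0, pi / 2]%classic (cst 1)
  (ellint_integrand l).
rewrite Rintegral_cst//= lebesgue_measure_itv/= lte_fin pi2 sube0 mul1r/=.
apply => //.
- by apply: continuous_compact_integrable;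
    [exact: segment_compact | apply: continuous_subspaceT => x; exact: cvg_cst].
- exact: integrable_ellint_integrand.
- by move=> t _; exact: ellint_integrand_ge1.
Qed.

(** The intermediate value theorem on [0, pi/2] makes [v] a value of
    [ellint_F l], so the choice operator in [jacobi_am] meets its
    specification. The preimage it picks could a priori be any real; the signs
    and the monotonicity of [ellint_F l] force it into (0, pi/2). *)
Lemma jacobi_amP l v : l ^+ 2 < 1 -> 0 < v < ellint_K l ->
  0 < jacobi_am l v < pi / 2 /\ ellint_F l (jacobi_am l v) = v.
Proof.
move=> l1 /andP[v0 vK].
have pi2 : 0 <= pi / 2 :> R by rewrite divr_ge0// pi_ge0.
have FE : ellint_F l (jacobi_am l v) = v.
  apply: (@xgetPex R 0 [set phi | ellint_F l phi = v]%classic).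
  have cF : {within `[0, pi / 2], continuous
      (fun phi => parameterized_integral lebesgue_measure 0 phi
                    (ellint_integrand l))}%classic.
    apply: parameterized_integral_continuous => //.
    exact: integrable_ellint_integrand.
  have [|phi] := @IVT R _ 0 (pi / 2) v pi2 cF.
    rewrite -!ellint_F_ge0E// ellint_F0 ellint_F_pihalf.
    by rewrite min_l ?max_r ?(ltW v0) ?(ltW vK)// ltW// ellint_K_gt0.
  by rewrite in_itv/= => /andP[phi0 _]; rewrite -ellint_F_ge0E//; exists phi.
split=> //; apply/andP; split; rewrite ltNge; apply/negP => am.
- by move: (ellint_F_le0 l1 am); rewrite FE leNgt v0.
- have pam : 0 <= (pi / 2 : R) <= jacobi_am l v by apply/andP.
  move: (le_ellint_F l1 pam).
  by rewrite FE ellint_F_pihalf leNgt vK.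
Qed.

(** Contraposition of [le_ellint_F], at the preimages of [u] and [v]. *)
Lemma le_jacobi_am l u v : l ^+ 2 < 1 -> 0 < u -> u <= v -> v < ellint_K l ->
  jacobi_am l u <= jacobi_am l v.
Proof.
move=> l1 u0; rewrite le_eqVlt => /predU1P[->//|uv vK].
have [_ uE] := jacobi_amP l1 (introT andP (conj u0 (lt_trans uv vK))).
have [/andP[v0 _] vE] := jacobi_amP l1 (introT andP (conj (lt_trans u0 uv) vK)).
rewrite leNgt; apply/negP => vu.
have /(le_ellint_F l1) : 0 <= jacobi_am l v <= jacobi_am l u by rewrite !ltW.
by rewrite uE vE leNgt uv.
Qed.

End EllipticIntegral.

(** * Angles of unimodular numbers *)

Section Angles.
Context {R : realType}.
Implicit Types a b t x y : R.

Lemma cisD x y : cis (x + y) = cis x * cis y :> R[i].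
Proof. by rewrite /cis cosD sinD; apply/eqP; rewrite eq_complex/= eqxx/= addrC. Qed.

Lemma cis_sum (I : Type) (r : seq I) (P : pred I) (f : I -> R) :
  cis (\sum_(i <- r | P i) f i) = \prod_(i <- r | P i) cis (f i) :> R[i].
Proof.
apply: (big_morph (@cis R) cisD).
by rewrite /cis cos0 sin0.
Qed.

Lemma cis_neq0 x : cis x != 0 :> R[i].
Proof.
apply/eqP => -[c0 s0]; move: (cos2Dsin2 x).
by rewrite c0 s0 expr0n/= addr0 => /esym/eqP; rewrite oner_eq0.
Qed.

(** Numerator and denominator are [cis t] times conjugate numbers, namely
    (1 + a) cos t +/- i (1 - a) sin t, and the angle [h] of the former is
    the arctangent below: the quotient has angle 2 h. *)
Lemma cis_moebius a t : 0 < a -> - (pi / 2) < t < pi / 2 ->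
  (cis t ^+ 2 + a%:C) / (1 + a%:C * cis t ^+ 2) =
  cis (2 * atan ((1 - a) / (1 + a) * tan t)).
Proof.
move=> a0 tpi; set h := atan _.
have c0 : 0 < cos t by exact: cos_gt0_pihalf.
have x0 : 0 < cos h by rewrite cos_gt0_pihalf// atan_gtNpi2 atan_ltpi2.
have a1 : 0 < 1 + a by rewrite addr_gt0.
have hE : (1 + a) * cos t * sin h = (1 - a) * sin t * cos h.
  have : tan h = (1 - a) / (1 + a) * tan t by rewrite atanK.
  rewrite /tan => /(congr1 (fun z => z * ((1 + a) * cos t * cos h))).
  have -> : sin h / cos h * ((1 + a) * cos t * cos h) =
            (1 + a) * cos t * sin h by field; rewrite gt_eqF.
  move=> ->; field.
  by rewrite !gt_eqF.
have tD := cos2Dsin2 t; have hD := cos2Dsin2 h.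
(* [lam] is the modulus of (1 + a) cos t + i (1 - a) sin t, in a form without
   square roots. *)
set lam := (1 + a) * cos t * cos h + (1 - a) * sin t * sin h.
have lamc : lam * cos h = (1 + a) * cos t.
  rewrite /lam mulrDl -[_ * sin h * _]mulrAC -hE -!mulrA -mulrDr -mulrDr.
  by rewrite -!expr2 hD mulr1.
have lams : lam * sin h = (1 - a) * sin t.
  rewrite /lam mulrDl [_ * cos h * _]mulrAC hE -!mulrA -mulrDr -mulrDr.
  by rewrite -!expr2 hD mulr1.
have num : cis t ^+ 2 + a%:C = cis t * (lam%:C * cis h).
  apply/eqP; rewrite eq_complex/= !mul0r subr0 addr0 lamc lams.
  apply/andP; split; apply/eqP; [|ring].
  have aE : a = a * (cos t ^+ 2 + sin t ^+ 2) by rewrite tD mulr1.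
  by rewrite {1}aE; ring.
have den : 1 + a%:C * cis t ^+ 2 = cis t * (lam%:C * cis (- h)).
  apply/eqP; rewrite eq_complex/= sinN cosN !mulrN !mul0r ?oppr0 ?addr0 ?subr0 lamc lams.
  apply/andP; split; apply/eqP; last by ring.
  by rewrite -[X in X + _]tD; ring.
have lam0 : lam%:C != 0 :> R[i].
  apply/eqP => -[lam0]; move: lamc; rewrite lam0 mul0r => /esym/eqP.
  by rewrite mulf_eq0 !gt_eqF.
rewrite num den -!mulf_div !divff ?cis_neq0// !mul1r.
apply: (mulIf (cis_neq0 (- h))); rewrite divfK ?cis_neq0// -cisD.
by congr cis; ring.
Qed.

(** The cosine of the argument is the real part, which is positive for an angle
    in (-pi/2, pi/2); on (-pi, pi] a positive cosine confines the argument
    to that interval. *)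
Lemma carg_cis_lt x : `|x| < pi / 2 -> `|carg (cis x)| < pi / 2.
Proof.
move=> xpi; have pi2 : 0 < pi / 2 :> R by rewrite divr_gt0// pi_gt0.
rewrite /carg; case: xgetP => [t _ [tpi xt]|_]; last by rewrite normr0.
have : 0 < cos t.
  have n1 : `|cis x| = 1 by rewrite normc_def/= cos2Dsin2 sqrtr1.
  move: xt; rewrite n1 mul1r => -[<- _]; apply: cos_gt0_pihalf.
  by rewrite -ltr_norml.
have tp : 0 <= `|t| <= pi by rewrite normr_ge0 ler_norml; case/andP: tpi => /ltW-> ->.
rewrite -cos_norm -cos_pihalf ltr_cos ?in_itv//=.
by rewrite (ltW pi2) ler_pdivrMr// ler_pMr ?pi_gt0// ler1n.
Qed.

(** The sign is fixed by the last term, and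
    S_(n+1) = f (n+1) - S_n. The bound [B] is kept free so that the induction
    hypothesis can be used with [B] equal to f (n+1). *)
Lemma alternating_sum_bounds (f : nat -> R) (n : nat) (B : R) :
  (forall i j : nat, (0 < i <= j)%N -> (j <= n)%N -> 0 <= f i <= f j) ->
  (forall j : nat, (0 < j <= n)%N -> f j <= B) -> 0 <= B ->
  0 <= \sum_(1 <= j < n.+1) (-1) ^+ (j + n) * f j <= B.
Proof.
elim: n B => [|n IH] B f_mono fB B0; first by rewrite big_geq// lexx.
have fn : f n.+1 <= B by apply: fB; rewrite ltnS leqnn.
have fn0 : 0 <= f n.+1 by have /andP[] := f_mono n.+1 n.+1 (leqnn _) (leqnn _).
have /andP[S0 S1] : 0 <= \sum_(1 <= j < n.+1) (-1) ^+ (j + n) * f j <= f n.+1.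
  apply: IH => //.
  - by move=> i j ij jn; apply: f_mono => //; exact: leqW.
  - move=> j /andP[j0 jn].
    have /andP[] : 0 <= f j <= f n.+1 by apply: f_mono; rewrite ?j0 ?leqnn ?leqW.
    by [].
rewrite big_nat_recr//= addnn -signr_odd odd_double mul1r.
have -> : \sum_(1 <= j < n.+1) (-1) ^+ (j + n.+1) * f j =
          - \sum_(1 <= j < n.+1) (-1) ^+ (j + n) * f j.
  by rewrite -sumrN; apply: eq_bigr => j _; rewrite addnS exprS mulN1r mulNr.
by rewrite addrC subr_ge0 S1 (le_trans _ fn)// gerBl.
Qed.

End Angles.

(** * Moebius transforms of unitary matrices *)

Section UnitaryCayley.
Context {C : numClosedFieldType} {m : nat}.
Implicit Types (X Y : 'M[C]_m) (a : C).
Local Open Scope sesquilinear_scope.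

Lemma unitarymxX X k : X \is unitarymx -> X ^+ k \is unitarymx.
Proof.
move=> uX; elim: k => [|k IH]; last by rewrite exprS; exact: mul_unitarymx.
by apply/unitarymxP; rewrite expr0 mul1mx trmx1 map_mx1.
Qed.

Lemma unitarymx_prod (I : Type) (r : seq I) (P : pred I) (F : I -> 'M[C]_m) :
  (forall i, P i -> F i \is unitarymx) -> \prod_(i <- r | P i) F i \is unitarymx.
Proof.
move=> uF; elim/big_ind : _ => //; last exact: mul_unitarymx.
by apply/unitarymxP; rewrite mul1mx trmx1 map_mx1.
Qed.

(** A row vector killed by 1 + a Y satisfies v = - a v Y; as Y preserves the
    norm, |v|^2 = a^2 |v|^2. *)
Lemma unit_oneD_unitary Y a :
  a \is Num.real -> a ^+ 2 != 1 -> Y \is unitarymx -> 1%:M + a *: Y \in unitmx.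
Proof.
move=> ra a1 uY; rewrite -row_free_unit -kermx_eq0; apply/eqP/row_matrixP => i.
rewrite row0; set v := row i _.
have vD : v *m (1%:M + a *: Y) = 0 by rewrite /v -row_mul mulmx_ker row0.
have vE : v = - (a *: (v *m Y)).
  by apply/eqP; rewrite -addr_eq0 -[X in X + _]mulmx1 scalemxAr -mulmxDr vD.
have /eqP := congr1 (fun w : 'rV_m => dotmx w w) vE.
have -> : dotmx (- (a *: (v *m Y))) (- (a *: (v *m Y))) = a ^+ 2 * dotmx v v.
  rewrite !dotmxE -scaleNr linearZ/= map_mxZ -scalemxAl -scalemxAr scalerA mxE.
  rewrite rmorphN/= (CrealP ra) mulrNN -expr2; congr (_ * _).
  by rewrite trmx_mul map_mxM mulmxA mulmxtVK.
rewrite -subr_eq0 -{1}[dotmx v v]mul1r -mulrBl mulf_eq0 subr_eq0 eq_sym.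
by rewrite (negPf a1)/= dnorm_eq0 => /eqP.
Qed.

(** Y Y^* = 1 turns the numerator into Y D^*, and D commutes with D^*. *)
Lemma unitarymx_cayley Y a : a \is Num.real -> a ^+ 2 != 1 -> Y \is unitarymx ->
  (Y + a%:M) *m invmx (1%:M + a *: Y) \is unitarymx.
Proof.
move=> ra a1 uY; set D := 1%:M + a *: Y.
have uD : D \in unitmx by exact: unit_oneD_unitary.
have DtE : D ^t* = 1%:M + a *: Y ^t*.
  by rewrite linearD/= linearZ/= trmx1 map_mxD map_mx1 map_mxZ/= (CrealP ra).
have YtY : Y ^t* *m Y = 1%:M by rewrite -(invmx_unitary uY) mulVmx ?unitarymx_unit.
have /unitarymxP YYt := uY.
have -> : Y + a%:M = Y *m D ^t*.
  by rewrite DtE mulmxDr mulmx1 -scalemxAr YYt scalemx1.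
rewrite -mulmxA; apply: mul_unitarymx => //.
have DDt : D ^t* *m D = D *m D ^t*.
  rewrite DtE /D !mulmxDl !mulmxDr !mul1mx !mulmx1 -!scalemxAl -!scalemxAr.
  by rewrite YYt YtY addrACA [_ *: _ + _ *: _]addrC addrACA.
have uDt : D ^t* \in unitmx by rewrite map_unitmx unitmx_tr.
have swap : D ^t* *m invmx D = invmx D *m D ^t*.
  by rewrite -[LHS](mulKmx uD) [D *m (_ *m _)]mulmxA -DDt mulmxK.
apply/unitarymxP; rewrite {1}swap trmx_mul map_mxM trmxCK trmx_inv map_invmx.
by rewrite -mulmxA mulKVmx// mulVmx.
Qed.

End UnitaryCayley.

(** * The Zolotarev coefficients *)

Section Zolotarev.
Context {R : realType}.
Implicit Types (n i j k : nat) (a b x y Theta : R).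

Lemma zolo_v_itv n Theta j : 0 < ellint_K (Num.sqrt (1 - cos Theta ^+ 2)) ->
  (0 < j <= n)%N ->
  0 < zolo_v n Theta j < ellint_K (Num.sqrt (1 - cos Theta ^+ 2)).
Proof.
move=> K0 /andP[j0 jn]; rewrite /zolo_v.
have n0 : 0 < 2 * n%:R + 1 :> R by rewrite ltr_wpDl// mulr_ge0.
have j1 : 1 <= j%:R :> R by rewrite ler1n.
have jn' : j%:R <= n%:R :> R by rewrite ler_nat.
rewrite pmulr_lgt0// gtr_pMl// ltr_pdivrMr// mul1r divr_gt0//=; lra.
Qed.

Lemma le_zolo_v n Theta i j : 0 < ellint_K (Num.sqrt (1 - cos Theta ^+ 2)) ->
  (i <= j)%N -> zolo_v n Theta i <= zolo_v n Theta j.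
Proof.
move=> K0 ij; rewrite /zolo_v ler_pM2r// ler_pM2r; last first.
  by rewrite invr_gt0 ltr_wpDl// mulr_ge0.
by rewrite lerD2r ler_pM2l// ler_nat.
Qed.

(** The quotient whose power of exponent 2 or -2 is [zolo_a]; isolating it
    separates its monotonicity in [j] from the alternating exponent. *)
Definition zolo_base n Theta j : R :=
  let l := cos Theta in
  let l' := Num.sqrt (1 - l ^+ 2) in
  let v := zolo_v n Theta j in
  (l * jacobi_sn v l' + jacobi_dn v l') / jacobi_cn v l'.

Lemma zolo_aE n Theta j :
  zolo_a n Theta j = zolo_base n Theta j ^ (2 * (-1) ^+ (j + n) : int).
Proof. by []. Qed.

(** Since l'^2 = 1 - l^2, dn^2 = 1 - l'^2 sn^2 = cn^2 + l^2 sn^2; dividing by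
    cn^2 gives 1 + (l tan)^2. *)
Lemma zolo_base_tan n Theta j :
  let phi := jacobi_am (Num.sqrt (1 - cos Theta ^+ 2)) (zolo_v n Theta j) in
  0 < cos phi ->
  zolo_base n Theta j =
  cos Theta * tan phi + Num.sqrt (1 + (cos Theta * tan phi) ^+ 2).
Proof.
move=> phi c0.
have l'E : Num.sqrt (1 - cos Theta ^+ 2) ^+ 2 = 1 - cos Theta ^+ 2.
  by rewrite sqr_sqrtr// -sin2cos2 sqr_ge0.
rewrite /zolo_base /jacobi_dn /jacobi_sn /jacobi_cn -/phi l'E.
rewrite mulrDl -mulrA -/(tan phi); congr (_ + _).
have -> : 1 - (1 - cos Theta ^+ 2) * sin phi ^+ 2 =
    (1 + (cos Theta * tan phi) ^+ 2) * cos phi ^+ 2.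
  have -> : (1 + (cos Theta * tan phi) ^+ 2) * cos phi ^+ 2 =
      cos phi ^+ 2 + cos Theta ^+ 2 * sin phi ^+ 2.
    by rewrite /tan; field; rewrite gt_eqF.
  by rewrite [cos phi ^+ 2]cos2sin2; ring.
by rewrite sqrtrM ?addr_ge0 ?sqr_ge0// sqrtr_sqr gtr0_norm// mulfK ?gt_eqF.
Qed.

(** x + sqrt (1 + x^2) exceeds 1 for x > 0 and increases with x; here
    x = l tan (am v_j), and v_j increases with j while staying in (0, K). *)
Lemma zolo_base_spec n Theta : 0 <= Theta < pi / 2 ->
  (forall j, (0 < j <= n)%N -> 1 < zolo_base n Theta j) /\
  (forall i j, (0 < i <= j)%N -> (j <= n)%N ->
     zolo_base n Theta i <= zolo_base n Theta j).
Proof.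
move=> hT; have /andP[T0 Tpi] := hT.
have l0 : 0 < cos Theta.
  apply: cos_gt0_pihalf; rewrite Tpi andbT; apply: lt_le_trans T0.
  by rewrite oppr_lt0 divr_gt0// pi_gt0.
set l' := Num.sqrt (1 - cos Theta ^+ 2).
have l'1 : l' ^+ 2 < 1.
  by rewrite sqr_sqrtr -?sin2cos2 ?sqr_ge0// sin2cos2 gtrBl exprn_gt0.
have K0 : 0 < ellint_K l' by exact: ellint_K_gt0.
pose phi j := jacobi_am l' (zolo_v n Theta j).
have phi_itv j : (0 < j <= n)%N -> 0 < phi j < pi / 2.
  by move=> jn; have [] := jacobi_amP l'1 (zolo_v_itv K0 jn).
have pi2 : 0 < pi / 2 :> R by rewrite divr_gt0// pi_gt0.
have phi_cos j : (0 < j <= n)%N -> 0 < cos (phi j).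
  move=> /phi_itv/andP[p0 p1]; apply: cos_gt0_pihalf.
  by rewrite p1 (lt_trans _ p0)// oppr_lt0.
have tan_gt0 j : (0 < j <= n)%N -> 0 < cos Theta * tan (phi j).
  move=> jn; rewrite mulr_gt0// /tan divr_gt0 ?phi_cos//.
  by rewrite sin_gt0_pihalf// phi_itv.
split=> [j jn|i j ij jn].
  rewrite zolo_base_tan ?phi_cos// -/l' -/(phi j) ltr_pwDl ?tan_gt0//.
  by rewrite -[leLHS]sqrtr1 ler_sqrt ?lerDl ?addr_ge0 ?sqr_ge0.
have [i0 ij'] := andP ij.
have i_itv : (0 < i <= n)%N by rewrite i0 (leq_trans ij').
have j_itv : (0 < j <= n)%N by rewrite (leq_trans i0)//.
have tanij : cos Theta * tan (phi i) <= cos Theta * tan (phi j).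
  have inT k : (0 < k <= n)%N -> phi k \in `](- (pi / 2)), (pi / 2)[.
    by move=> /phi_itv/andP[k0 k1]; rewrite in_itv/= k1 (lt_trans _ k0)// oppr_lt0.
  rewrite ler_pM2l// leNgt ltr_tan ?inT// -leNgt.
  have /andP[vi0 _] := zolo_v_itv K0 i_itv; have /andP[_ vjK] := zolo_v_itv K0 j_itv.
  by rewrite le_jacobi_am// le_zolo_v.
rewrite !zolo_base_tan ?phi_cos// -/l' -/(phi i) -/(phi j) lerD//.
by rewrite ler_sqrt ?addr_ge0 ?sqr_ge0// lerD2l ler_pXn2r// nnegrE ltW ?tan_gt0.
Qed.

(** Up to sign, (1 - a_j) / (1 + a_j): replacing a_j by its inverse only changes
    the sign of that ratio. *)
Definition zolo_kappa n Theta j : R :=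
  (zolo_base n Theta j ^+ 2 - 1) / (zolo_base n Theta j ^+ 2 + 1).

Lemma zolo_a_gt0 n Theta j : 0 < zolo_base n Theta j -> 0 < zolo_a n Theta j.
Proof. by move=> b0; rewrite zolo_aE exprz_gt0. Qed.

Lemma zolo_a_signed n Theta j : 0 < zolo_base n Theta j ->
  (1 - zolo_a n Theta j) / (1 + zolo_a n Theta j) =
  - ((-1) ^+ (j + n) * zolo_kappa n Theta j).
Proof.
rewrite zolo_aE /zolo_kappa; set b := zolo_base _ _ _ => b0.
have b2 : 0 < b ^+ 2 by rewrite exprn_gt0.
have h : b ^+ 2 + 1 != 0 by rewrite gt_eqF// addr_gt0.
rewrite -(signr_odd int) -(signr_odd R); case: (odd _) => /=.
  rewrite !expr1 mulrN1 -[b ^ (- 2)]/(b ^- 2).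
  field; by rewrite h gt_eqF.
rewrite !expr0 mulr1 mul1r -[b ^ 2]/(b ^+ 2).
field; by [].
Qed.

Lemma zolo_kappa_itv n Theta j :
  1 < zolo_base n Theta j -> 0 < zolo_kappa n Theta j < 1.
Proof.
rewrite /zolo_kappa; set b := zolo_base _ _ _ => b1.
have b2 : 1 < b ^+ 2 by rewrite exprn_egt1.
have b3 : 0 < b ^+ 2 + 1 by lra.
rewrite divr_gt0 ?subr_gt0//= ltr_pdivrMr// mul1r; lra.
Qed.

Lemma le_zolo_kappa n Theta i j :
  1 < zolo_base n Theta i -> zolo_base n Theta i <= zolo_base n Theta j ->
  zolo_kappa n Theta i <= zolo_kappa n Theta j.
Proof.
rewrite /zolo_kappa; set b := zolo_base _ _ i; set c := zolo_base _ _ j.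
move=> b1 bc; have b2 : b ^+ 2 <= c ^+ 2.
  by rewrite ler_pXn2r// nnegrE ?(le_trans _ bc)// ltW// (lt_trans ltr01).
have b0 : 1 < b ^+ 2 by rewrite exprn_egt1.
rewrite ler_pdivrMr; last by lra.
rewrite mulrAC ler_pdivlMr; last by lra.
nra.
Qed.

(** a_j = 1 would give kappa_j = 0 by [zolo_a_signed], and a_j is positive. *)
Lemma sqr_zolo_a_neq1 n Theta j : 1 < zolo_base n Theta j ->
  zolo_a n Theta j ^+ 2 != 1.
Proof.
move=> b1; have b0 := lt_trans ltr01 b1.
have a0 := zolo_a_gt0 b0.
rewrite sqrf_eq1 negb_or [_ == -1]gt_eqF ?andbT; last first.
  by apply: lt_trans a0; rewrite ltrN10.
apply/eqP => aE; move: (zolo_a_signed b0); rewrite aE subrr mul0r.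
move/esym/eqP; rewrite oppr_eq0 mulf_eq0 signr_eq0/=.
by have /andP[k0 _] := zolo_kappa_itv b1; rewrite gt_eqF.
Qed.

(** The angle is Theta - 2 S, with S an alternating sum of angles that increase
    with j and do not exceed Theta, because the kappa_j are below 1. *)
Lemma zolo_r_cis n Theta : 0 <= Theta < pi / 2 ->
  exists2 x, `|x| <= Theta & zolo_r n Theta (cis Theta) = cis x.
Proof.
move=> hT; have /andP[T0 Tpi] := hT.
have [b1 bmono] := zolo_base_spec n hT.
have Tint : - (pi / 2) < Theta < pi / 2.
  by rewrite Tpi andbT; apply: lt_le_trans T0; rewrite oppr_lt0 divr_gt0// pi_gt0.
have tan0 : 0 <= tan Theta.
  have cT : 0 < cos Theta by exact: cos_gt0_pihalf.
  rewrite /tan divr_ge0 ?(ltW cT)// sin_ge0_pi// T0/= (le_trans (ltW Tpi))//.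
  by rewrite ler_pdivrMr// ler_pMr ?pi_gt0// ler1n.
pose beta j := atan (zolo_kappa n Theta j * tan Theta).
have factorE j : (0 < j <= n)%N ->
    (cis Theta ^+ 2 + (zolo_a n Theta j)%:C) /
      (1 + (zolo_a n Theta j)%:C * cis Theta ^+ 2) =
    cis (- (2 * ((-1) ^+ (j + n) * beta j))).
  move=> jn; have b0 := lt_trans ltr01 (b1 _ jn).
  rewrite cis_moebius// ?zolo_a_gt0// zolo_a_signed// mulNr atanN mulrN.
  congr (cis (- (2 * _))); rewrite /beta -signr_odd; case: (odd _).
    by rewrite expr1 !mulN1r mulNr atanN.
  by rewrite expr0 !mul1r.
pose S := \sum_(1 <= j < n.+1) (-1) ^+ (j + n) * beta j.
have /andP[S0 ST] : 0 <= S <= Theta.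
  apply: alternating_sum_bounds => //.
  - move=> i j ij jn; have i1 : 1 < zolo_base n Theta i.
      by apply: b1; case/andP: ij => -> ij; exact: leq_trans jn.
    have /andP[k0 _] := zolo_kappa_itv i1.
    apply/andP; split; first by rewrite -atan0 le_atan// mulr_ge0// ltW.
    by rewrite le_atan// ler_wpM2r// le_zolo_kappa// bmono.
  - move=> j jn; have /andP[_ k1] := zolo_kappa_itv (b1 _ jn).
    rewrite -[leRHS]tanK; last by rewrite in_itv/= Tint.
    by rewrite /beta le_atan// ler_piMl// ltW.
exists (Theta - 2 * S); first by rewrite ler_norml; apply/andP; split; lra.
rewrite /zolo_r cisD; congr (_ * _).
rewrite /S mulr_sumr -sumrN cis_sum; apply: eq_big_nat => j jn.
exact: factorE.
Qed.

Lemma sqr_zolo_aC_neq1 n Theta j : 1 < zolo_base n Theta j ->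
  (zolo_a n Theta j)%:C ^+ 2 != 1 :> R[i].
Proof.
move=> b1; rewrite -rmorphXn/= -(rmorph1 (real_complex R)).
by rewrite (inj_eq (@complexI R)) sqr_zolo_a_neq1.
Qed.

Lemma zolo_den_unit n Theta j m (X : 'M[R[i]]_m) :
  1 < zolo_base n Theta j -> X \is unitarymx ->
  zolo_den n Theta X j \in unitmx.
Proof.
move=> b1 uX; apply: unit_oneD_unitary; last exact: unitarymxX.
- by apply/complex_realP; exists (zolo_a n Theta j).
- exact: sqr_zolo_aC_neq1.
Qed.

End Zolotarev.

(** * Unitarity of the iterates *)

Theorem proposition3p1 (R : realType) (n : nat) (hn : (0 < n)%N)
    (Theta : R) (hTheta : 0 <= Theta < pi / 2)
    (m : nat) (A : 'M[R[i]]_m)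
    (X : nat -> 'M[R[i]]_m) (T : nat -> R)
    (hX0 : X 0%N = A)
    (hXS : forall k : nat, X k.+1 = zolo_rmx n (T k) (X k))
    (hT0 : T 0%N = Theta)
    (hTS : forall k : nat, T k.+1 = `|carg (zolo_r n (T k) (cis (T k)))|)
    (hA : A \is unitarymx) :
  forall k : nat,
    [/\ 0 <= T k < pi / 2,
        forall j : nat, (1 <= j <= n)%N -> zolo_den n (T k) (X k) j \in unitmx
      & X k \is unitarymx].
Proof.
suff inv k : 0 <= T k < pi / 2 /\ X k \is unitarymx.
  move=> k; have [hT uX] := inv k; have [b1 _] := zolo_base_spec n hT.
  by split=> // j jn; rewrite zolo_den_unit// b1.
elim: k => [|k [hT uX]]; first by rewrite hT0 hX0.
split.
  have [x xT rE] := zolo_r_cis n hT.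
  rewrite hTS normr_ge0/= rE; apply: carg_cis_lt.
  by apply: le_lt_trans xT _; case/andP: hT.
rewrite hXS; apply: mul_unitarymx => //.
rewrite big_seq; apply: unitarymx_prod => j.
rewrite mem_index_iota ltnS => jn; have [b1 _] := zolo_base_spec n hT.
apply: unitarymx_cayley; last exact: unitarymxX.
- by apply/complex_realP; exists (zolo_a n (T k) j).
- by rewrite sqr_zolo_aC_neq1 ?b1.
Qed.
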